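(* For $\boldsymbol{n} = (n_1,n_2,n_3,n_4) \in \mathbb{Z}^4$ define $$A(\boldsymbol{n}) = \sum_{k \in \mathbb{Z}} \binom{n_1}{k}\binom{n_3}{k}\binom{n_1+n_2-k}{n_1}\binom{n_3+n_4-k}{n_3}$$ (this sum has only finitely many nonzero terms). Then for all primes $p \geq 5$, all integers $r \geq 1$ and all $\boldsymbol{n} \in \mathbb{Z}^4$, $$A(p^r \boldsymbol{n}) \equiv A(p^{r-1}\boldsymbol{n}) \pmod{p^{3r}}.$$
   Context: For all integers $n, k$, the binomial coefficient is defined by $\binom{n}{k} = \lim_{z \to 0} \frac{\Gamma(z+n+1)}{\Gamma(z+k+1)\Gamma(z+n-k+1)}$. This is a finite integer for all $n,k\in\mathbb{Z}$, agrees with the usual binomial coefficient for $n \ge 0$, satisfies $\binom{n}{k}=\binom{n}{n-k}$, and for integers is nonzero only if ($k\ge0$ and $n-k\ge0$) or ($n<0$ and $k\ge 0$) or ($n<0$ and $n-k\ge0$); e.g. $\binom{-3}{-5}=\binom{-3}{2}=6$. For nonnegative $\boldsymbol{n}$, $A(\boldsymbol{n})$ is the coefficient of $x_1^{n_1}x_2^{n_2}x_3^{n_3}x_4^{n_4}$ in $1/((1-x_1-x_2)(1-x_3-x_4)-x_1x_2x_3x_4)$. *)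

(* Defs.v *)
From mathcomp Require Import all_boot all_order all_algebra.
Set Implicit Arguments. Unset Strict Implicit. Unset Printing Implicit Defensive.
Import Order.TTheory GRing.Theory Num.Theory.
Local Open Scope ring_scope.

(* Binomial coefficient for all integers n, k, equal to the limit
   lim_{z->0} Gamma(z+n+1)/(Gamma(z+k+1)Gamma(z+n-k+1)):
   - n >= 0 : usual binomial (0 unless 0 <= k <= n);
   - n < 0, k >= 0 : (-1)^k C(-n+k-1, k);
   - n < 0, k <= n : (-1)^(n-k) C(-k-1, n-k);
   - otherwise 0. *)
Definition binz (n k : int) : int :=
  if 0 <= n then
    (if (0 <= k) && (k <= n) then ('C(`|n|%N, `|k|%N))%:Z else 0)
  else if 0 <= k then
    (-1) ^+ `|k|%N * ('C((`|n| + `|k|).-1, `|k|%N))%:Z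
  else if k <= n then
    (-1) ^+ `|n - k|%N * ('C((`|k|).-1, `|n - k|%N))%:Z
  else 0.

Definition A_term (n1 n2 n3 n4 k : int) : int :=
  binz n1 k * binz n3 k * binz (n1 + n2 - k) n1 * binz (n3 + n4 - k) n3.

(* The sum over k in Z; every nonzero term has |k| <= |n1|+|n2|+|n3|+|n4|,
   so summing over k in [-N, N] with that N is the full sum. *)
Definition A (n1 n2 n3 n4 : int) : int :=
  let N := (`|n1| + `|n2| + `|n3| + `|n4|)%N in
  \sum_(0 <= i < (N + N).+1) A_term n1 n2 n3 n4 (i%:Z - N%:Z).

(* Main.v *)
Require Import Defs.
From mathcomp Require Import all_boot all_order all_algebra all_solvable.
From mathcomp Require Import zify ring.
Set Implicit Arguments. Unset Strict Implicit. Unset Printing Implicit Defensive.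
Import Order.TTheory GRing.Theory Num.Theory.
Local Open Scope ring_scope.

(* Let T_r(k) be the k-th term of A(p^r n).  Jacobsthal's congruence, which says that
   binom(pN, pK) / binom(N, K) is 1 modulo p^3 N K (N - K), gives
   T_r(pk) = T_(r-1)(k) modulo p^(3r).  For k prime to p, absorbing k into the first two
   binomials gives T_r(k) = p^(2r) n1 n3 F_r(k - 1) / k^2, where the product F_r of four
   binomials satisfies F_r(j) = F_(r-1)(floor(j / p)) modulo p^r.  Since p >= 5, the sum
   of 1 / k^2 over the k prime to p in an interval of length p^s vanishes modulo p^s,
   and descending through F_r, F_(r-1), ..., F_0 shows that the sum of F_r(k - 1) / k^2
   over k prime to p vanishes modulo p^r. *)

(** * Binomial coefficients with integer arguments *)

Lemma binz_nat (n k : nat) : binz n%:Z k%:Z = ('C(n, k))%:Z.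
Proof.
rewrite /binz !lez_nat /=; case: leqP => // nk.
by rewrite bin_small.
Qed.

Lemma binz_eq0 (n k : int) : k < 0 -> n - k < 0 -> binz n k = 0.
Proof.
move=> k0 nk; rewrite /binz.
have -> : (0 <= k) = false by lia.
have -> : (k <= n) = false by lia.
by case: ifP.
Qed.

Lemma binz_eq0_top (n k : int) : 0 <= n -> (k < 0) || (n < k) -> binz n k = 0.
Proof. by move=> n0 h; rewrite /binz n0; case: ifP => //; lia. Qed.

(** For [k >= 0] the binomial is a polynomial in [n], so this formula covers both signs of [n]. For
    negative [n] the sign [(-1) ^+ k] is spread over the [k] factors, taken in reverse order. *)
Lemma binz_ffact (n : int) (k : nat) :
  (k`!)%:Z * binz n k%:Z = \prod_(i < k) (n - i%:Z).
Proof.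
case: n => n.
  rewrite binz_nat -PoszM mulnC bin_ffact ffact_prod.
  case: (leqP k n) => kn.
    rewrite (big_morph _ PoszM (erefl _)); apply: eq_bigr => i _.
    by have := ltn_ord i; lia.
  rewrite (bigD1 (Ordinal kn)) //= subnn mul0n.
  by rewrite (bigD1 (Ordinal kn)) //= subrr mul0r.
rewrite /binz /=.
rewrite mulrCA -PoszM mulnC bin_ffact ffact_prod.
rewrite (big_morph _ PoszM (erefl _)).
rewrite (reindex_inj rev_ord_inj) /= -[X in (-1) ^+ X]card_ord -prodr_const.
rewrite -big_split; apply: eq_bigr => i _ /=.
by rewrite mulN1r; have := ltn_ord i; lia.
Qed.

Lemma binzE (n : int) (k : nat) (x : int) :
  (k`!)%:Z * x = \prod_(i < k) (n - i%:Z) -> binz n k%:Z = x.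
Proof.
rewrite -binz_ffact => /mulfI -> //.
by have := fact_gt0 k; lia.
Qed.

(** Reversing the falling factorial and negating each of its [k] factors turns one side into the
    other. *)
Lemma binz_reflect (n k : int) : 0 <= k ->
  binz n k = (-1) ^+ `|k|%N * binz (k - n - 1) k.
Proof.
case: k => k // _; apply: binzE.
rewrite mulrCA binz_ffact (reindex_inj rev_ord_inj) /=.
rewrite -[X in (-1) ^+ X]card_ord -prodr_const -big_split /=.
by apply: eq_bigr => i _; have := ltn_ord i; rewrite mulN1r; lia.
Qed.

Lemma binz_sym (n k : int) : binz n k = binz n (n - k).
Proof.
rewrite /binz; have -> : n - (n - k) = k by ring.
case: (leP 0 n) => n0.
  have -> : (0 <= n - k) && (n - k <= n) = (0 <= k) && (k <= n) by lia.
  case: ifP => // h; rewrite -bin_sub; last by lia.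
  by congr (Posz 'C(_, _)); lia.
case: (leP 0 k) => k0.
  have -> : (0 <= n - k) = false by lia.
  have -> : (n - k <= n) by lia.
  by congr (_ * Posz 'C(_, _)); lia.
have -> : (n - k <= n) = false by lia.
have -> : (0 <= n - k) = (k <= n) by lia.
case: ifP => // kn; congr (_ * Posz 'C(_, _)); lia.
Qed.

Lemma binz_absorb_ge0 (n k : int) : 0 <= k -> k * binz n k = n * binz (n - 1) (k - 1).
Proof.
case: k => // -[|k] _.
  rewrite mul0r; case: (leP 1 n) => n1; first by rewrite binz_eq0_top ?mulr0 //; lia.
  have [->|n0] := eqVneq n 0; first by rewrite mul0r.
  by rewrite binz_eq0 ?mulr0 //; lia.
have -> : k.+1%:Z - 1 = k by lia.
have k0 : (k`!)%:Z != 0 by have := fact_gt0 k; lia.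
apply: (mulfI k0); rewrite mulrA -PoszM mulnC -factS binz_ffact mulrCA binz_ffact.
rewrite big_ord_recl subr0; congr (_ * _); apply: eq_bigr => i _.
by rewrite /= /bump; lia.
Qed.

(** For [k >= 0], both sides times [k!] equal the product [n (n - 1) ... (n - k)]. Negative [k]
    reduces to the other absorption rule by symmetry. *)
Lemma binz_absorb_top (n k : int) : (n - k) * binz n k = n * binz (n - 1) k.
Proof.
case: (leP 0 k) => [|k0].
  case: k => // k _; have k0 : (k`!)%:Z != 0 by have := fact_gt0 k; lia.
  apply: (mulfI k0); rewrite !(mulrCA (k`!)%:Z) !binz_ffact.
  transitivity (\prod_(i < k.+1) (n - i%:Z)); first by rewrite big_ord_recr mulrC.
  rewrite big_ord_recl /= subr0.
  by congr (_ * _); apply: eq_bigr => i _; rewrite /bump; lia.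
case: (ltP (n - k) 0) => nk; first by rewrite !binz_eq0 ?mulr0 //; lia.
rewrite binz_sym [binz (n - 1) k]binz_sym binz_absorb_ge0 //.
by congr (_ * binz _ _); ring.
Qed.

Lemma binz_absorb (n k : int) : k * binz n k = n * binz (n - 1) (k - 1).
Proof.
rewrite binz_sym [binz (n - 1) _]binz_sym.
have -> : n - 1 - (k - 1) = n - k by ring.
by rewrite -binz_absorb_top; congr (_ * _); ring.
Qed.

Lemma binz_step (n k : int) : k * binz n k = (n - k + 1) * binz n (k - 1).
Proof.
have := binz_absorb_top n (k - 1); rewrite binz_absorb => <-.
by congr (_ * _); ring.
Qed.

(** * Ratios congruent to 1 and floors *)

(* X / Y lies in 1 + d Z_(p), in a form that also makes sense when X = Y = 0. *)
Definition ratio_cong (p : nat) (d X Y : int) : Prop :=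
  exists b c : int, [/\ ~~ (p %| b)%Z, (d %| c - b)%Z & b * X = c * Y].

Lemma prime_dvdzM (p : nat) (a b : int) : prime p ->
  (p %| a * b)%Z = (p %| a)%Z || (p %| b)%Z.
Proof. by move=> pp; rewrite !dvdzE abszM Euclid_dvdM. Qed.

Lemma prime_Gauss_dvdz (p e : nat) (a b : int) : prime p -> ~~ (p %| a)%Z ->
  ((p ^ e)%N %| a * b)%Z = ((p ^ e)%N %| b)%Z.
Proof.
move=> pp pa; rewrite Gauss_dvdzr // coprimezE /=.
by rewrite coprimeXl // prime_coprime.
Qed.

Section RatioCong.
Variables (p : nat) (pp : prime p).

Lemma prime_ndvdz1 : ~~ (p %| 1)%Z.
Proof. by rewrite dvdz1 /=; case: p pp => [|[|n]]. Qed.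

Lemma ratio_cong_refl (d X : int) : ratio_cong p d X X.
Proof. by exists 1, 1; rewrite subrr dvdz0 prime_ndvdz1. Qed.

Lemma ratio_congM (d X Y Z W : int) :
  ratio_cong p d X Y -> ratio_cong p d Z W -> ratio_cong p d (X * Z) (Y * W).
Proof.
move=> [b [c [pb dc E]]] [b' [c' [pb' dc' E']]].
exists (b * b'), (c * c'); split; last by rewrite mulrACA E E' mulrACA.
  by rewrite prime_dvdzM // negb_or pb.
have -> : c * c' - b * b' = (c - b) * c' + b * (c' - b') by ring.
by apply: rpredD; [apply: dvdz_mulr | apply: dvdz_mull].
Qed.

(** The induction step for ratios: the new factor [y / x] is 1 modulo [d] because [x] is a unit at
    [p]. *)
Lemma ratio_cong_unit (d x y X Y : int) : ~~ (p %| x)%Z -> (d %| x - y)%Z ->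
  ratio_cong p d X Y -> forall Z, x * Z = y * X -> ratio_cong p d Z Y.
Proof.
move=> px dxy [b [c [pb dc E]]] Z Exy.
exists (x * b), (y * c); split; last by rewrite -mulrA mulrCA Exy mulrCA E mulrA.
  by rewrite prime_dvdzM // negb_or px.
have -> : y * c - x * b = y * (c - b) - (x - y) * b by ring.
by apply: rpredB; [apply: dvdz_mull | apply: dvdz_mulr].
Qed.

Lemma ratio_cong_cancel (d l X Y : int) : l != 0 ->
  ratio_cong p d (l * X) (l * Y) -> ratio_cong p d X Y.
Proof.
move=> l0 [b [c [pb dc E]]]; exists b, c; split=> //.
by apply: (mulfI l0); rewrite mulrCA E mulrCA.
Qed.

Lemma ratio_cong_dvd (d d' X Y : int) : (d' %| d)%Z ->
  ratio_cong p d X Y -> ratio_cong p d' X Y.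
Proof.
by move=> dd [b [c [pb dc E]]]; exists b, c; split=> //; apply: dvdz_trans dc.
Qed.

(** The return to ordinary congruences: [b * (X - Y) = (c - b) * Y], so the power of [p] in [Y] adds
    to the precision of the ratio. *)
Lemma ratio_cong_dvdB (e f : nat) (X Y : int) :
  ratio_cong p (p ^ e)%N X Y -> ((p ^ f)%N %| Y)%Z -> ((p ^ (e + f))%N %| X - Y)%Z.
Proof.
move=> [b [c [pb dc E]]] dY; rewrite -(prime_Gauss_dvdz _ _ pp pb).
have -> : b * (X - Y) = (c - b) * Y by rewrite mulrBr E -mulrBl.
by rewrite expnD PoszM dvdz_mul.
Qed.
End RatioCong.

(** * Binomials under floor division of an argument by [p] *)

Section Floor.
Variables (p : nat) (pp : prime p) (p_odd : odd p).

Lemma ndvdz_small (l : int) (t : nat) : (0 < t < p)%N -> ~~ (p %| p%:Z * l + t%:Z)%Z.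
Proof.
move=> /andP[t0 tp]; rewrite rpredDl; last exact: dvdz_mulr.
rewrite dvdzE /=.
by apply/negP => /dvdn_leq; lia.
Qed.

Lemma signz_odd (m n : nat) : odd m = odd n -> (-1) ^+ m = (-1) ^+ n :> int.
Proof. by move=> E; rewrite -signr_odd E signr_odd. Qed.

(** Passing from lower index [j - 1] to [j] multiplies the left binomial by [(p Q - j) / j]. This is
    -1 modulo [p Q] if [p] does not divide [j]; at [j = p n] it is [(Q - n) / n], exactly the factor
    gained on the right. *)
Lemma binz_pred_floor (Q l : int) (t : nat) : (t < p)%N ->
  ratio_cong p (p%:Z * Q)
    (binz (p%:Z * Q - 1) (p%:Z * l + t%:Z)) ((-1) ^+ t * binz (Q - 1) l).
Proof.
have stept (k : int) (u : nat) : (u.+1 < p)%N ->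
    ratio_cong p (p%:Z * Q)
      (binz (p%:Z * Q - 1) (p%:Z * k + u%:Z)) ((-1) ^+ u * binz (Q - 1) k) ->
    ratio_cong p (p%:Z * Q)
      (binz (p%:Z * Q - 1) (p%:Z * k + u.+1%:Z)) ((-1) ^+ u.+1 * binz (Q - 1) k).
  move=> up IH.
  set j := p%:Z * k + u.+1%:Z.
  have IH' : ratio_cong p (p%:Z * Q)
      (- binz (p%:Z * Q - 1) (j - 1)) ((-1) ^+ u.+1 * binz (Q - 1) k).
    have -> : j - 1 = p%:Z * k + u%:Z by rewrite /j; lia.
    rewrite exprS -mulrA !mulN1r -[- binz _ _]mulN1r -[- (_ * _)]mulN1r.
    exact: ratio_congM (ratio_cong_refl pp _ _) IH.
  apply: (ratio_cong_unit pp (x := j) (y := j - p%:Z * Q) _ _ IH').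
  - by apply: ndvdz_small.
  - by have -> : j - (j - p%:Z * Q) = p%:Z * Q by ring.
  - by rewrite binz_step; ring.
have nat_case (n : nat) (u : nat) : (u < p)%N ->
    ratio_cong p (p%:Z * Q)
      (binz (p%:Z * Q - 1) (p%:Z * n%:Z + u%:Z)) ((-1) ^+ u * binz (Q - 1) n%:Z).
  elim: n u => [|n IHn] u.
    elim: u => [_|u IHu up]; last by apply: stept => //; apply: IHu; lia.
    rewrite mulr0 addr0 expr0 mul1r.
    have b1 (x : int) : binz x 0 = 1.
      by rewrite (@binzE x 0 1) // big_ord0.
    by rewrite !b1; apply: ratio_cong_refl.
  elim: u => [_|u IHu up]; last by apply: stept => //; apply: IHu; lia.
  (* Crossing a multiple of [p]: both sides get the same factor, and the sign accumulated over the
     preceding [p - 1] steps is 1 because [p] is odd. *)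
  apply: (@ratio_cong_cancel _ _ (p%:Z * n.+1%:Z)); first by rewrite mulf_neq0 //; lia.
  rewrite addr0 binz_step expr0 mul1r -mulrA binz_step.
  have -> : p%:Z * Q - 1 - p%:Z * n.+1%:Z + 1 = p%:Z * (Q - n.+1%:Z) by ring.
  have -> : p%:Z * n.+1%:Z - 1 = p%:Z * n%:Z + p.-1%:Z by nia.
  have -> : p%:Z * ((Q - 1 - n.+1%:Z + 1) * binz (Q - 1) (n.+1%:Z - 1))
     = p%:Z * (Q - n.+1%:Z) * ((-1) ^+ p.-1 * binz (Q - 1) n%:Z).
    have -> : (-1) ^+ p.-1 = 1 :> int by rewrite (@signz_odd _ 0) //; lia.
    rewrite mul1r mulrA; congr (_ * _ * binz _ _); lia.
  by apply: (ratio_congM pp); [apply: ratio_cong_refl | apply: IHn; lia].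
move=> tp; case: l => l; first exact: nat_case.
set L := Negz l.
case: (ltP (Q - 1 - L) 0) => h.
  rewrite !binz_eq0 ?mulr0 //; try nia.
  exact: ratio_cong_refl.
(* Symmetry makes the lower index nonnegative and replaces the digit [t] by [p - 1 - t], which has
   the same parity. *)
rewrite binz_sym [binz (Q - 1) L]binz_sym.
have -> : p%:Z * Q - 1 - (p%:Z * L + t%:Z) = p%:Z * (Q - 1 - L) + (p.-1 - t)%N%:Z by nia.
have -> : (-1) ^+ t = (-1) ^+ (p.-1 - t) :> int by apply: signz_odd; lia.
case: (Q - 1 - L) h => // n _; apply: nat_case; lia.
Qed.

(* binz a b = +- binz (- b - 1) (a - b) reduces this to binz_pred_floor with Q = - K. *)
Lemma binz_lower_multiple_floor (K l : int) (t : nat) : (t < p)%N ->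
  ratio_cong p (p%:Z * K) (binz (p%:Z * l + t%:Z) (p%:Z * K)) (binz l K).
Proof.
have ge_case (k : int) (u : nat) : (u < p)%N -> K <= k ->
    ratio_cong p (p%:Z * K) (binz (p%:Z * k + u%:Z) (p%:Z * K)) (binz k K).
  move=> up Kk.
  rewrite binz_sym [binz k K]binz_sym [binz k _]binz_reflect; last lia.
  rewrite binz_reflect; last nia.
  have -> : p%:Z * k + u%:Z - p%:Z * K - (p%:Z * k + u%:Z) - 1
     = p%:Z * (- K) - 1 by ring.
  have -> : k - K - k - 1 = - K - 1 by ring.
  have -> : p%:Z * k + u%:Z - p%:Z * K = p%:Z * (k - K) + u%:Z by ring.
  have -> : (-1) ^+ `|(k - K)|%N = (-1) ^+ `|(p%:Z * (k - K) + u%:Z)%R|%N * (-1) ^+ u :> int.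
    have : 0 <= k - K by lia.
    case: (k - K) => // n _.
    by rewrite -PoszM -PoszD -exprD; apply: signz_odd; rewrite /= !oddD oddM p_odd; lia.
  rewrite -[_ * _ * binz _ _]mulrA; apply: (ratio_congM pp); first exact: ratio_cong_refl.
  apply: (@ratio_cong_dvd p (p%:Z * - K)); first by rewrite mulrN dvdzE abszN.
  exact: binz_pred_floor.
move=> tp; case: (leP K l) => lK; first exact: ge_case.
case: (ltP K 0) => K0.
  by rewrite !binz_eq0 //; try nia; apply: ratio_cong_refl.
case: (leP 0 l) => l0.
  by rewrite !binz_eq0_top //; try nia; apply: ratio_cong_refl.
(* Here [l < 0 <= K]; reflection replaces [l] by [K - l - 1], which is at least [K]. *)
rewrite binz_reflect; last nia.
rewrite [binz l K]binz_reflect //.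
have -> : p%:Z * K - (p%:Z * l + t%:Z) - 1 = p%:Z * (K - l - 1) + (p.-1 - t)%N%:Z by nia.
have -> : (-1) ^+ `|(p%:Z * K)%R|%N = (-1) ^+ `|K|%N :> int.
  by apply: signz_odd; rewrite abszM oddM p_odd.
apply: (ratio_congM pp); first exact: ratio_cong_refl.
by apply: ge_case; lia.
Qed.
End Floor.

(** * Sums of inverse squares *)

Section BigBlocks.
Variables (R : Type) (idx : R) (op : Monoid.com_law idx).

Lemma big_nat_blocks (q L : nat) (P : pred nat) (F : nat -> R) :
  \big[op/idx]_(0 <= i < q * L | P i) F i =
  \big[op/idx]_(0 <= m < L)
    \big[op/idx]_(0 <= t < q | P (q * m + t)%N) F (q * m + t)%N.
Proof.
elim: L => [|L IHL]; first by rewrite muln0 !big_geq.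
rewrite big_nat_recr //= -IHL mulnS [(q + _)%N]addnC.
rewrite (big_cat_nat (n := q * L)) ?leq_addr //=; congr (op _ _).
rewrite -{1}[(q * L)%N]add0n big_addn addKn.
by apply: eq_big => i; rewrite addnC.
Qed.

Lemma big_nat_recr_false (n : nat) (P : pred nat) (F : nat -> R) : P n = false ->
  \big[op/idx]_(0 <= i < n.+1 | P i) F i = \big[op/idx]_(0 <= i < n | P i) F i.
Proof.
by move=> Pn; rewrite big_mkcond big_nat_recr //= Pn Monoid.mulm1 -big_mkcond.
Qed.

(** Stated for a general operation, since it splits both the products in Jacobsthal's congruence and
    the sum [A]. *)
Lemma big_nat_multiples (p k : nat) (F : nat -> R) : (0 < p)%N ->
  \big[op/idx]_(0 <= i < p * k) F i.+1 =
  op (\big[op/idx]_(0 <= i < p * k | ~~ (p %| i.+1)%N) F i.+1)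
     (\big[op/idx]_(0 <= i < k) F (p * i.+1)%N).
Proof.
case: p => // p _; rewrite !big_nat_blocks -big_split /=.
apply: eq_bigr => m _; rewrite big_nat_recr //= -addnS -mulnSr.
rewrite big_nat_recr_false; last by rewrite -addnS -mulnSr dvdn_mulr.
congr (op _ _).
rewrite big_nat_cond [RHS]big_nat_cond; apply: eq_bigl => t.
case: ltnP => // tp /=.
by rewrite -addnS dvdn_addr ?dvdn_mulr // gtnNdvd.
Qed.
End BigBlocks.

(** The involution [j -> n - j] preserves the non-multiples of [p]; the endpoint [j = n] is a
    multiple and drops out. *)
Lemma big_nat_nonmultiples_rev (R : Type) (idx : R) (op : Monoid.com_law idx)
    (p n : nat) (F : nat -> R) : (p %| n)%N ->
  \big[op/idx]_(0 <= i < n | ~~ (p %| i.+1)%N) F i.+1 =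
  \big[op/idx]_(0 <= i < n | ~~ (p %| i.+1)%N) F (n - i.+1)%N.
Proof.
case: n => [|n] pn; first by rewrite !big_geq.
rewrite !big_nat_recr_false ?pn //.
rewrite big_nat_rev /= add0n big_nat_cond [RHS]big_nat_cond.
apply: eq_big => i; last by move=> /andP[/andP[_ h] _]; congr F; lia.
case: ltnP => h //=; congr (~~ _).
have -> : (n - i.+1).+1 = (n.+1 - i.+1)%N by lia.
by rewrite dvdn_subr //; lia.
Qed.


Section InvSq.
Variables (p : nat) (pp : prime p).

(* By Euler's theorem this integer is inverse to k ^+ 2 modulo p ^ R when p does not divide k. *)
Definition inv_sq (R : nat) (k : int) : int := k ^+ (2 * (totient (p ^ R)).-1).

Lemma inv_sqP (R s : nat) (k : int) : (s <= R)%N -> ~~ (p %| k)%Z ->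
  ((p ^ s)%N %| k ^+ 2 * inv_sq R k - 1)%Z.
Proof.
move=> sR pk; apply: (@dvdz_trans (p ^ R)%N).
  by rewrite dvdzE /= dvdn_exp2l.
have t0 : (0 < totient (p ^ R))%N by rewrite totient_gt0 expn_gt0 prime_gt0.
have cop : coprime (`|k| ^ 2)%N (p ^ R)%N.
  by rewrite coprimeXl // coprimeXr // coprime_sym prime_coprime.
rewrite /inv_sq -exprD.
have -> : (2 + 2 * (totient (p ^ R)).-1 = 2 * totient (p ^ R))%N by lia.
(* The even exponent allows [k] to be replaced by its absolute value, so Euler's theorem for natural
   numbers applies. *)
rewrite exprM -real_normK ?num_real // -abszE.
rewrite -eqz_mod_dvd -!natz -!rmorphXn /= !natz !modz_nat.
by have := Euler_exp_totient cop => ->.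
Qed.

Section Residues.
Variables (s : nat) (s_gt0 : (0 < s)%N).
Let q := (p ^ s)%N.

Let q_gt1 : (1 < q)%N.
Proof. by rewrite -(exp1n s) ltn_exp2r // prime_gt1. Qed.

Lemma intr_Zp_eq0 (k : int) : (k%:~R == 0 :> 'Z_q) = (q %| k)%Z.
Proof.
have nat_case (n : nat) : (n%:R == 0 :> 'Z_q) = (q %| n)%N.
  by rewrite -val_eqE /= val_Zp_nat.
case: k => n; first exact: nat_case.
by rewrite NegzE rmorphN oppr_eq0 nat_case.
Qed.

Lemma intr_Zp_unit (k : int) : ((k%:~R : 'Z_q) \is a GRing.unit) = ~~ (p %| k)%Z.
Proof.
have nat_case (n : nat) : ((n%:R : 'Z_q) \is a GRing.unit) = ~~ (p %| n)%N.
  by rewrite unitZpE // coprime_pexpl // prime_coprime.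
case: k => n; first exact: nat_case.
by rewrite NegzE rmorphN unitrN nat_case.
Qed.

Lemma sum_Zp (V : nmodType) (G : 'Z_q -> V) :
  \sum_(0 <= i < q) G i%:R = \sum_x G x.
Proof.
rewrite -{1}(Zp_cast q_gt1) big_mkord; apply: eq_bigr => i _.
by rewrite natr_Zp.
Qed.
End Residues.

(* Multiplication by 2 permutes the units mod p^s, so the sum S of their
   inverse squares satisfies S = S / 4, and 3 is invertible. *)
Lemma sum_inv_sq_block (R s : nat) (c : int) : (5 <= p)%N -> (s <= R)%N ->
  ((p ^ s)%N %| \sum_(0 <= i < p ^ s | ~~ (p %| c + i%:Z)%Z) inv_sq R (c + i%:Z))%Z.
Proof.
move=> p5; case: s => [|s] sR; first by rewrite expn0 dvd1z.
set q := (p ^ s.+1)%N.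
pose e := (2 * (totient (p ^ R)).-1)%N.
(* Extension by zero makes the sum run over the whole ring, where translation by [c] and
   multiplication by 2 are permutations. *)
pose g (x : 'Z_q) := if x \is a GRing.unit then x ^+ e else 0.
have gE (k : int) : g k%:~R = (if ~~ (p %| k)%Z then inv_sq R k else 0)%:~R.
  rewrite /g intr_Zp_unit //; case: ifP => // _.
  by rewrite /inv_sq rmorphXn.
rewrite -intr_Zp_eq0 // big_mkcond rmorph_sum /=.
have -> : \sum_(0 <= i < q)
   (if ~~ (p %| c + i%:Z)%Z then inv_sq R (c + i%:Z) else 0)%:~R = \sum_x g x.
  rewrite [RHS](reindex_inj (addrI (c%:~R : 'Z_q))) /= -sum_Zp //.
  by apply: eq_bigr => i _; rewrite -gE rmorphD.
have ndvd (n : nat) : (0 < n < p)%N -> (n%:~R : 'Z_q) \is a GRing.unit.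
  move=> /andP[n0 np]; rewrite intr_Zp_unit //; apply/negP.
  by rewrite dvdzE => /(dvdn_leq n0); lia.
have u2 : (2%:~R : 'Z_q) \is a GRing.unit by apply: (ndvd 2%N); lia.
have u3 : (3%:~R : 'Z_q) \is a GRing.unit by apply: (ndvd 3%N); lia.
set S := \sum_x g x.
have S2 : S = (2%:~R) ^+ e * S.
  rewrite {1}/S (reindex_inj (mulrI u2)) /= /S mulr_sumr; apply: eq_bigr => x _.
  by rewrite /g unitrMr //; case: ifP; rewrite ?mulr0 // exprMn.
have inv4 : (2%:~R : 'Z_q) ^+ 2 * 2%:~R ^+ e = 1.
  have p2 : ~~ (p %| 2%:Z)%Z by apply/negP; rewrite dvdzE => /dvdn_leq; lia.
  have := inv_sqP sR p2; rewrite -(intr_Zp_eq0 (ltn0Sn s)) rmorphB rmorphM subr_eq0.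
  by rewrite /inv_sq -/e !rmorphXn => /eqP.
have : 3%:~R * S = 0.
  have -> : 3%:~R = (2%:~R : 'Z_q) ^+ 2 - 1 by rewrite -[X in _ - X]/(1%:~R) -rmorphXn -rmorphB.
  by rewrite mulrBl mul1r {1}S2 mulrA inv4 mul1r subrr.
by move=> S0; apply/eqP/(mulrI u3); rewrite S0 mulr0.
Qed.

Lemma sum_inv_sq (R s L : nat) (c : int) : (5 <= p)%N -> (s <= R)%N ->
  ((p ^ s)%N %| \sum_(0 <= i < p ^ s * L | ~~ (p %| c + i%:Z)%Z) inv_sq R (c + i%:Z))%Z.
Proof.
move=> p5 sR; rewrite big_nat_blocks; apply: rpred_sum => m _.
have := sum_inv_sq_block (c + (p ^ s * m)%N%:Z) p5 sR.
by congr (_ %| _)%Z; apply: eq_big => t; rewrite -addrA.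
Qed.
End InvSq.

(** * Jacobsthal's congruence *)

Lemma dvdz_prodB (d : int) (I : Type) (s : seq I) (P : pred I) (f g : I -> int) :
  (forall i, P i -> (d %| f i - g i)%Z) ->
  (d %| \prod_(i <- s | P i) f i - \prod_(i <- s | P i) g i)%Z.
Proof.
move=> fg; elim/big_rec2: _ => [|i x y Pi dxy]; first by rewrite subrr dvdz0.
have -> : f i * y - g i * x = f i * (y - x) + x * (f i - g i) by ring.
by apply: rpredD; apply: dvdz_mull => //; apply: fg.
Qed.

(** First-order expansion in [y]. The [w i] need only invert the [c i] modulo [t], because they
    occur multiplied by [y] and [d] divides [y * t]. *)
Lemma dvdz_prod_shift (d t y : int) (I : Type) (s : seq I) (P : pred I) (c w : I -> int) :
  (d %| y * t)%Z -> (d %| y ^+ 2)%Z ->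
  (forall i, P i -> (t %| c i * w i - 1)%Z) ->
  (d %| \prod_(i <- s | P i) (y + c i)
        - \prod_(i <- s | P i) c i * (1 + y * \sum_(i <- s | P i) w i))%Z.
Proof.
move=> dyt dyy cw; elim/big_rec3: _ => [|i W C Y Pi IH].
  by rewrite mulr0 addr0 mulr1 subrr dvdz0.
have -> : (y + c i) * Y - c i * C * (1 + y * (w i + W)) =
    (y + c i) * (Y - C * (1 + y * W)) + C * W * y ^+ 2 - C * (y * (c i * w i - 1)) by ring.
apply: rpredB; first by apply: rpredD; apply: dvdz_mull.
by apply: dvdz_mull; apply: dvdz_trans dyt _; rewrite dvdz_mul // cw.
Qed.

Lemma prime_ndvdz_prod (p : nat) (I : Type) (s : seq I) (P : pred I) (f : I -> int) :
  prime p -> (forall i, P i -> ~~ (p %| f i)%Z) ->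
  ~~ (p %| \prod_(i <- s | P i) f i)%Z.
Proof.
move=> pp pf; elim/big_ind: _ => // [|x y px py]; first exact: prime_ndvdz1.
by rewrite prime_dvdzM // negb_or px.
Qed.

Lemma binz_rising (m k : nat) :
  (k`!)%:Z * binz (m + k)%N k = \prod_(0 <= i < k) (m%:Z + i.+1%:Z).
Proof.
rewrite binz_ffact -(big_mkord predT (fun i => (m + k)%N%:Z - i%:Z)) big_nat_rev /=.
by rewrite !big_nat; apply: eq_bigr => i; lia.
Qed.

Section Jacobsthal.
Variables (p : nat) (pp : prime p).

(** In [(pk)! binz (p (m + k)) (p k) = prod (p m + j)], the multiples of [p] contribute [p^k k!] on
    the left and [p^k k! binz (m + k) k] on the right; [p^k k!] cancels. *)
Lemma binz_multiple_ratio (m k : nat) :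
  \prod_(0 <= i < p * k | ~~ (p %| i.+1)%N) i.+1%:Z * binz (p * (m + k))%N (p * k)%N =
  \prod_(0 <= i < p * k | ~~ (p %| i.+1)%N) ((p * m)%N%:Z + i.+1%:Z)
    * binz (m + k)%N k.
Proof.
have p0 : (0 < p)%N by apply: prime_gt0.
have nz : ((p ^ k)%N * k`!)%:Z != 0 by have := fact_gt0 k; have := expn_gt0 p k; nia.
have prodE (n : nat) :
    \prod_(0 <= i < k) ((p * n)%N%:Z + (p * i.+1)%N%:Z)
    = (p ^ k)%N%:Z * \prod_(0 <= i < k) (n%:Z + i.+1%:Z).
  have -> : (p ^ k)%N%:Z = \prod_(0 <= i < k) p%:Z.
    by rewrite prodr_const_nat subn0 -!natz -natrX.
  by rewrite -big_split; apply: eq_bigr => i _ /=; rewrite !PoszM mulrDr.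
have factE (n : nat) : (n`!)%:Z = \prod_(0 <= i < n) i.+1%:Z.
  have := binz_rising 0 n; rewrite binz_nat add0n binn mulr1 => ->.
  by apply: eq_bigr => i _; rewrite add0r.
have := binz_rising (p * m) (p * k); rewrite -mulnDr factE.
rewrite (big_nat_multiples _ _ (fun i => i%:Z)) //.
rewrite (big_nat_multiples _ _ (fun i => (p * m)%N%:Z + i%:Z)) //.
rewrite prodE -binz_rising.
have -> : \prod_(0 <= i < k) (p * i.+1)%N%:Z = (p ^ k)%N%:Z * (k`!)%:Z.
  rewrite factE; have := prodE 0%N; rewrite muln0.
  by under eq_bigr do rewrite add0r; move=> ->; under eq_bigr do rewrite add0r.
move=> /= E; apply: (mulfI nz); rewrite PoszM.
set U := \prod_(_ <= _ < _ | _) _ in E *.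
set V := \prod_(_ <= _ < _ | _) _ in E *.
set C := binz (p * _)%N _ in E *. set D := binz _ _ in E *.
set a := Posz (p ^ k) in E *; set b := Posz _ in E *.
by transitivity (U * (a * b) * C); [ring | rewrite E; ring].
Qed.

Hypothesis p_ge5 : (5 <= p)%N.

(* With j ranging over the integers prime to p in [1, pk], the ratio of the two
   binomials is V / U for V = prod (pm + j) and U = prod j.  Pairing j with pk - j
   gives V^2 = prod (y + j (pk - j)) with y = p^2 m (m + k), hence
   V^2 = U^2 (1 - y sum j^-2) modulo y p k and y^2. *)
Lemma jacobsthal_logn_le (m k e : nat) : (0 < k)%N -> (0 < m)%N ->
  (logn p k <= logn p m)%N -> (p ^ e %| p ^ 3 * ((m + k) * k * m))%N ->
  ratio_cong p (p ^ e)%N (binz (p * (m + k))%N (p * k)%N) (binz (m + k)%N k).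
Proof.
have p2 : ~~ (p %| 2)%Z.
  by apply/negP; rewrite dvdzE => /dvdn_leq /= /(_ isT); rewrite leqNgt (leq_trans _ p_ge5).
move=> k0 m0 vkm.
have [k' pk' kE] := pfactor_coprime pp k0.
have pm : (p ^ logn p k %| m)%N by apply: (dvdn_trans (dvdn_exp2l p vkm)); exact: pfactor_dvdnn.
set v := logn p k in kE vkm pm *.
move=> pe.
(* [t] is the exact power of [p] in [p k], so [y * t] is [p ^ 3 * ((m + k) * k * m)] up to the
   factor [k'] prime to [p]. *)
pose t := (p ^ v.+1)%N; pose y := (p ^ 2 * (m * (m + k)))%N.
have dyt : ((p ^ e)%N %| y%:Z * t%:Z)%Z.
  rewrite -PoszM dvdzE /=; move: pe.
  have -> : (p ^ 3 * ((m + k) * k * m) = y * t * k')%N.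
    by rewrite {2}kE /y /t !expnS; ring.
  by rewrite Gauss_dvdl // coprimeXl.
(* Since [p ^ v] divides [m], [t] divides [y]; this is where the valuations of [k] and [m] are
   compared. *)
have dyy : ((p ^ e)%N %| y%:Z ^+ 2)%Z.
  apply: dvdz_trans dyt _; rewrite expr2 dvdz_mul // dvdzE /= /y /t expnSr.
  by rewrite mulnA [(_ ^ 2 * m)%N]mulnC dvdn_mulr // dvdn_mul // dvdn_exp.
pose P i := ~~ (p %| i.+1)%N.
set U := \prod_(0 <= i < p * k | P i) i.+1%:Z.
set V := \prod_(0 <= i < p * k | P i) ((p * m)%N%:Z + i.+1%:Z).
pose c (i : nat) : int := i.+1%:Z * ((p * k)%N%:Z - i.+1%:Z).
(* With [j = i + 1], [c i = j (p k - j)] is [- j ^ 2] modulo [t], whence the sign. *)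
pose w (i : nat) : int := - inv_sq p v.+1 (1 + i%:Z).
have tpk : (t %| p * k)%N by rewrite /t expnS dvdn_mul // /v pfactor_dvdnn.
have UU : U ^+ 2 = \prod_(0 <= i < p * k | P i) c i.
  rewrite expr2 {2}/U big_nat_nonmultiples_rev ?dvdn_mulr //.
  rewrite -big_split big_nat_cond [RHS]big_nat_cond; apply: eq_bigr => i /andP[/andP[_ ik] _] /=.
  by rewrite /c -subzn.
have VV : V ^+ 2 = \prod_(0 <= i < p * k | P i) (y%:Z + c i).
  rewrite expr2 {2}/V (big_nat_nonmultiples_rev _ (fun i => (p * m)%N%:Z + i%:Z)) ?dvdn_mulr //.
  rewrite -big_split big_nat_cond [RHS]big_nat_cond; apply: eq_bigr => i /andP[/andP[_ ik] _] /=.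
  by rewrite -subzn // /y /c -mulnn !PoszM PoszD; ring.
have dVU : ((p ^ e)%N %| V ^+ 2 - U ^+ 2)%Z.
  rewrite VV UU.
  set X := \prod_(_ <= _ < _ | _) c _.
  set Y := \prod_(_ <= _ < _ | _) _; set W := \sum_(0 <= i < p * k | P i) w i.
  have -> : Y - X = (Y - X * (1 + y%:Z * W)) + X * (y%:Z * W) by ring.
  have cw (i : nat) : P i -> (t %| c i * w i - 1)%Z.
    move=> Pi; have := inv_sqP pp (leqnn v.+1) (k := 1 + i%:Z); rewrite -intS => /(_ Pi) h.
    have -> : c i * w i - 1 = (i.+1%:Z ^+ 2 * inv_sq p v.+1 i.+1 - 1)
        - (p * k)%N%:Z * (i.+1%:Z * inv_sq p v.+1 i.+1).
      by rewrite /c /w -intS; ring.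
    by apply: rpredB => //; apply: dvdz_mulr.
  have YX : ((p ^ e)%N %| Y - X * (1 + y%:Z * W))%Z.
    exact: (@dvdz_prod_shift _ _ _ nat (index_iota 0 (p * k)) P c w dyt dyy cw).
  apply: rpredD => //.
  apply: dvdz_mull; apply: dvdz_trans dyt _; rewrite dvdz_mul //.
  rewrite /W /w sumrN rpredN.
  have /dvdnP[L ->] := tpk; rewrite mulnC.
  exact: (@sum_inv_sq p pp v.+1 v.+1 L 1 p_ge5 (leqnn _)).
have pU : ~~ (p %| U)%Z by apply: prime_ndvdz_prod.
have pVU : (p %| V - U)%Z.
  apply: dvdz_prodB => i _; rewrite addrK PoszM; exact: dvdz_mulr.
exists U, V; split=> //; last exact: binz_multiple_ratio.
(* Modulo [p], [V + U] is [2 * U], a unit, so the whole power of [p] divides [V - U]. *)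
move: dVU; rewrite subr_sqr mulrC prime_Gauss_dvdz //.
have -> : V + U = (V - U) + 2 * U by ring.
by rewrite rpredDl // prime_dvdzM // negb_or p2 pU.
Qed.

(** Symmetry exchanges [m] and [k], so their valuations may be assumed ordered. *)
Lemma jacobsthal_nat (m k e : nat) : (p ^ e %| p ^ 3 * ((m + k) * k * m))%N ->
  ratio_cong p (p ^ e)%N (binz (p * (m + k))%N (p * k)%N) (binz (m + k)%N k).
Proof.
case: (posnP k) => [-> _|k0].
  by rewrite muln0 !binz_nat !bin0; apply: ratio_cong_refl.
case: (posnP m) => [-> _|m0].
  by rewrite add0n !binz_nat !binn; apply: ratio_cong_refl.
case: (leqP (logn p k) (logn p m)) => [|/ltnW] v h; first exact: jacobsthal_logn_le.
have flip (a b : nat) : binz (a + b)%N b = binz (b + a)%N a.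
  by rewrite binz_sym [(b + a)%N]addnC; congr binz; lia.
rewrite mulnDr flip [binz (m + k)%N k]flip -mulnDr.
by apply: jacobsthal_logn_le; rewrite // addnC mulnAC.
Qed.

Lemma jacobsthal (N K : int) (e : nat) : ((p ^ e)%N %| (p ^ 3)%N%:Z * (N * K * (N - K)))%Z ->
  ratio_cong p (p ^ e)%N (binz (p%:Z * N) (p%:Z * K)) (binz N K).
Proof.
have p0 : (0 < p)%N by apply: prime_gt0.
have nat_case (m k : nat) : ((p ^ e)%N %| (p ^ 3)%N%:Z * ((m + k)%N%:Z * k%:Z * m%:Z))%Z ->
    ratio_cong p (p ^ e)%N (binz (p%:Z * (m + k)%N%:Z) (p%:Z * k%:Z)) (binz (m + k)%N%:Z k%:Z).
  by rewrite -!PoszM => h; apply: jacobsthal_nat.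
have nonneg_case (n k : int) : 0 <= k ->
    ((p ^ e)%N %| (p ^ 3)%N%:Z * (n * k * (n - k)))%Z ->
    ratio_cong p (p ^ e)%N (binz (p%:Z * n) (p%:Z * k)) (binz n k).
  move=> k0 h; case: (leP 0 n) => n0.
    case: (ltP n k) => nk.
      by rewrite !binz_eq0_top ?ler0z //; try nia; apply: ratio_cong_refl.
    have [k' kE] : exists k' : nat, k = k' by exists `|k|%N; lia.
    have [m mE] : exists m : nat, n - k = m by exists `|(n - k)%R|%N; lia.
    have nE : n = (m + k')%N by lia.
    by move: h; rewrite mE nE kE; apply: nat_case.
  (* For [n < 0 <= k], reflection and absorption express [(k - n) * binz n k] through
     [binz (k - n) k], whose top is a sum of the naturals [- n] and [k]. The product
     [n * k * (n - k)] is unchanged. *)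
  apply: (@ratio_cong_cancel _ _ (p%:Z * (k - n))); first by rewrite mulf_neq0 //; lia.
  have E (a b : int) : 0 <= b -> (b - a) * binz a b = (-1) ^+ `|b|%N * - a * binz (b - a) b.
    move=> b0; rewrite binz_reflect // mulrCA -binz_absorb_top.
    have -> : b - a - b = - a by ring.
    by rewrite mulrA.
  have -> : p%:Z * (k - n) * binz n k = p%:Z * ((-1) ^+ `|k|%N * - n * binz (k - n) k).
    by rewrite -mulrA E.
  rewrite {1}mulrBr E; last by nia.
  have -> : (-1) ^+ `|(p%:Z * k)%R|%N = (-1) ^+ `|k|%N :> int.
    apply: signz_odd; rewrite abszM oddM /=.
    by case: (even_prime pp) => [p2|->] //; move: p_ge5; rewrite p2.
  have -> : (-1) ^+ `|k|%N * - (p%:Z * n) * binz (p%:Z * k - p%:Z * n) (p%:Z * k)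
     = p%:Z * ((-1) ^+ `|k|%N * - n) * binz (p%:Z * k - p%:Z * n) (p%:Z * k) by ring.
  rewrite [X in ratio_cong _ _ _ X]mulrA -mulrBr.
  apply: (ratio_congM pp); first exact: ratio_cong_refl.
  have [k' kE] : exists k' : nat, k = k' by exists `|k|%N; lia.
  have [m mE] : exists m : nat, - n = m by exists `|n|%N; lia.
  have nkE : k - n = (m + k')%N by lia.
  rewrite nkE kE; apply: nat_case; rewrite -nkE -kE -mE.
  by have <- : n * k * (n - k) = (k - n) * k * - n by ring.
move=> h; case: (leP 0 K) => K0; first exact: nonneg_case.
case: (ltP (N - K) 0) => NK.
  by rewrite !binz_eq0 -?mulrBr //; try nia; apply: ratio_cong_refl.
rewrite binz_sym [binz N K]binz_sym -mulrBr; apply: nonneg_case => //.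
have -> : N * (N - K) * (N - (N - K)) = N * K * (N - K) by ring.
by [].
Qed.
End Jacobsthal.

(** * The supercongruence *)

Lemma binz_neq0 (n k : int) : binz n k != 0 ->
  (0 <= n /\ 0 <= k <= n) \/ (n < 0 /\ ((0 <= k) || (k <= n))).
Proof.
rewrite /binz; case: (leP 0 n) => n0.
  by case: ifP => // h _; left.
by case: ifP => [_ _|k0]; [right | case: ifP => // _ _; right].
Qed.

Lemma A_term_neq0 (n1 n2 n3 n4 k : int) : A_term n1 n2 n3 n4 k != 0 ->
  (`|k| <= `|n1| + `|n2| + `|n3| + `|n4|)%N.
Proof.
rewrite /A_term !mulf_eq0 !negb_or -!andbA.
by case/and4P => /binz_neq0 h1 /binz_neq0 h2 /binz_neq0 h3 /binz_neq0 h4; lia.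
Qed.

(** The added terms vanish. The index runs over [1 - B, ..., B], so for [B = p ^ s * M] the range
    has length divisible by [p ^ s] and splits into full blocks. *)
Lemma A_wide (n1 n2 n3 n4 : int) (B : nat) : (`|n1| + `|n2| + `|n3| + `|n4| < B)%N ->
  A n1 n2 n3 n4 = \sum_(0 <= i < 2 * B) A_term n1 n2 n3 n4 (i.+1%:Z - B%:Z).
Proof.
rewrite /A; set N := (`|n1| + _ + _ + _)%N => NB.
have T0 (k : int) : (N < `|k|)%N -> A_term n1 n2 n3 n4 k = 0.
  by move=> Nk; apply/eqP; apply: contraTT Nk => /A_term_neq0; rewrite -leqNgt.
have -> : (2 * B = (B - N).-1 + ((N + N).+1 + (B - N)))%N by lia.
rewrite [RHS](big_cat_nat (n := (B - N).-1)) ?leq_addr //=.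
have sum0 (a b : nat) : (forall i, (a <= i < b)%N -> (N < `|(i.+1%:Z - B%:Z)%R|)%N) ->
    \sum_(a <= i < b) A_term n1 n2 n3 n4 (i.+1%:Z - B%:Z) = 0.
  by move=> h; rewrite big_nat big1 // => i /h /T0.
rewrite sum0 ?add0r; last by move=> i; lia.
rewrite [RHS](big_cat_nat (n := (B - N).-1 + (N + N).+1)) ?leq_add2l ?leq_addr //=.
rewrite [X in _ = _ + X]sum0 ?addr0; last by move=> i; lia.
rewrite -[X in _ = \sum_(X <= _ < _) _]add0n big_addn addKn.
by apply: eq_bigr => i _; congr A_term; lia.
Qed.

(** * Terms with index divisible by [p], then terms with index prime to [p] *)

Section Supercongruence.
Variables (p : nat) (pp : prime p) (p_ge5 : (5 <= p)%N).

Let p_odd : odd p.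
Proof. by case: (even_prime pp) p_ge5 => [->|]. Qed.

Lemma dvdz_expnl (a b : nat) (x y : int) : (a <= b)%N -> ((p ^ b)%N %| x)%Z -> ((p ^ a)%N %| x)%Z.
Proof. by move=> ab; apply: dvdz_trans; rewrite dvdzE /= dvdn_exp2l. Qed.

(** Absorption [k * binz m k = m * binz (m - 1) (k - 1)] bounds the valuation of [binz m k] below by
    that of [m] minus that of [k]. *)
Lemma binz_multiple_dvd (r s : nat) (m k k' : int) : (s <= r)%N ->
  k = (p ^ s)%N%:Z * k' -> (s < r)%N ==> ~~ (p %| k')%Z -> ((p ^ r)%N %| m)%Z ->
  ((p ^ (r - s))%N %| binz m k)%Z.
Proof.
move=> sr kE; rewrite leq_eqVlt in sr; case/orP: sr => [/eqP <-|sr].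
  by rewrite subnn dvd1z.
rewrite sr /= => pk' rm; rewrite -(prime_Gauss_dvdz _ _ pp pk').
have ps : (p ^ s)%N%:Z != 0 by have := expn_gt0 p s; have := prime_gt0 pp; lia.
rewrite -(dvdz_mul2l ps) -PoszM -expnD subnKC 1?ltnW // mulrA -kE binz_absorb.
exact: dvdz_mulr.
Qed.

(* With s = min(r, v_p(k)), the four ratios are 1 modulo p^(r + 2s + 3), while the
   product of the first two binomials is divisible by p^(2(r - s)). *)
Lemma A_term_multiple (r : nat) (m1 m2 m3 m4 k : int) :
  ((p ^ r)%N %| m1)%Z -> ((p ^ r)%N %| m2)%Z -> ((p ^ r)%N %| m3)%Z -> ((p ^ r)%N %| m4)%Z ->
  ((p ^ (3 * r.+1))%N %| A_term (p%:Z * m1) (p%:Z * m2) (p%:Z * m3) (p%:Z * m4) (p%:Z * k)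
     - A_term m1 m2 m3 m4 k)%Z.
Proof.
move=> d1 d2 d3 d4.
have [s [k' [sr kE pk']]] : exists s k', [/\ (s <= r)%N, k = (p ^ s)%N%:Z * k'
    & (s < r)%N ==> ~~ (p %| k')%Z].
  have [|rk] := boolP ((p ^ r)%N %| k)%Z.
    by case/dvdzP => k' ->; exists r, k'; rewrite ltnn mulrC.
  have k0 : (0 < `|k|)%N by rewrite absz_gt0; apply: contraNneq rk => ->; rewrite dvdz0.
  have [k' pk' kE] := pfactor_coprime pp k0.
  exists (logn p `|k|), (if k < 0 then - k'%:Z else k'%:Z); split.
  - rewrite leqNgt; apply: contra rk => /ltnW rs; rewrite dvdzE /=.
    exact: dvdn_trans (dvdn_exp2l p rs) (pfactor_dvdnn _ _).
  - have -> (x y : int) : x * (if k < 0 then - y else y) = if k < 0 then - (y * x) else y * x.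
      by case: ifP; rewrite ?mulrN mulrC.
    by rewrite -PoszM -kE; case: ifP; lia.
  - have -> : (p %| if (k < 0)%R then - k'%:Z else k'%:Z)%Z = (p %| k')%N.
      by rewrite dvdzE; case: ifP; rewrite ?abszN.
    by rewrite -prime_coprime // pk' implybT.
have sk : ((p ^ s)%N %| k)%Z by rewrite kE dvdz_mulr.
(* In each binomial [binz N K], one of [N], [K] is divisible by [p ^ r], and the other and [N - K]
   by [p ^ s]; the last 3 is Jacobsthal's. *)
pose e := (r + s + s + 3)%N.
have jac (N K : int) (a b c : nat) : ((p ^ a)%N %| N)%Z -> ((p ^ b)%N %| K)%Z ->
    ((p ^ c)%N %| N - K)%Z -> (a + b + c = r + s + s)%N ->
    ratio_cong p (p ^ e)%N (binz (p%:Z * N) (p%:Z * K)) (binz N K).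
  move=> dN dK dNK E; apply: jacobsthal => //.
  rewrite /e addnC expnD PoszM dvdz_mul // -E !expnD !PoszM.
  by rewrite !dvdz_mul.
have ps m : ((p ^ r)%N %| m)%Z -> ((p ^ s)%N %| m)%Z by apply: dvdz_expnl.
have jac1 m : ((p ^ r)%N %| m)%Z ->
    ratio_cong p (p ^ e)%N (binz (p%:Z * m) (p%:Z * k)) (binz m k).
  by move=> dm; apply: (jac _ _ r s s) => //; apply: rpredB => //; apply: ps.
have jac2 m m' : ((p ^ r)%N %| m)%Z -> ((p ^ r)%N %| m')%Z ->
    ratio_cong p (p ^ e)%N (binz (p%:Z * m + p%:Z * m' - p%:Z * k) (p%:Z * m)) (binz (m + m' - k) m).
  move=> dm dm'; rewrite -mulrDr -mulrBr; apply: (jac _ _ s r s) => //; last by lia.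
    by apply: rpredB => //; apply: rpredD; apply: ps.
  have -> : m + m' - k - m = m' - k by ring.
  by apply: rpredB => //; apply: ps.
have E : (3 * r.+1 = e + ((r - s) + (r - s)))%N by rewrite /e; lia.
rewrite E; apply: ratio_cong_dvdB => //.
  by rewrite /A_term; do 3?[apply: (ratio_congM pp)]; [apply: jac1 | apply: jac1 | apply: jac2 | apply: jac2].
rewrite /A_term -!mulrA mulrA; apply: dvdz_mulr.
by rewrite expnD PoszM dvdz_mul //; apply: binz_multiple_dvd kE pk' _.
Qed.

Variables (n1 n2 n3 n4 : int).

(* For k = j + 1, absorption gives k ^+ 2 * A_term (p^s n) k = p^(2s) n1 n3 A_cofactor s j. *)
Definition A_cofactor (s : nat) (j : int) : int :=
  binz ((p ^ s)%N%:Z * n1 - 1) j * binz ((p ^ s)%N%:Z * n3 - 1) j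
  * binz ((p ^ s)%N%:Z * (n1 + n2) - 1 - j) ((p ^ s)%N%:Z * n1)
  * binz ((p ^ s)%N%:Z * (n3 + n4) - 1 - j) ((p ^ s)%N%:Z * n3).

(** The first two binomials each contribute a sign [(-1) ^+ t], and these cancel; in the last two
    the digit [t] becomes [p - 1 - t], which the floor removes. *)
Lemma A_cofactor_floor (s t : nat) (l : int) : (t < p)%N ->
  ((p ^ s.+1)%N %| A_cofactor s.+1 (p%:Z * l + t%:Z) - A_cofactor s l)%Z.
Proof.
move=> tp; rewrite -[s.+1 in X in (X %| _)%Z]addn0.
suff H : ratio_cong p (p ^ s.+1)%N (A_cofactor s.+1 (p%:Z * l + t%:Z)) (A_cofactor s l).
  by apply: (ratio_cong_dvdB pp H); rewrite expn0 dvd1z.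
have weak (n X Y : int) : ratio_cong p (p%:Z * ((p ^ s)%N%:Z * n)) X Y ->
    ratio_cong p (p ^ s.+1)%N X Y.
  by apply: ratio_cong_dvd; rewrite mulrA -PoszM -expnS dvdz_mulr.
have QE n : (p ^ s.+1)%N%:Z * n = p%:Z * ((p ^ s)%N%:Z * n) by rewrite expnS PoszM mulrA.
have topE (Q : int) : p%:Z * Q - 1 - (p%:Z * l + t%:Z) = p%:Z * (Q - 1 - l) + (p.-1 - t)%N%:Z.
  by clear -tp; nia.
have sgn (a b c d : int) : a * b * c * d = (((-1) ^+ t * a) * ((-1) ^+ t * b)) * c * d.
  by rewrite mulrACA -exprD addnn -mul2n exprM sqrrN !expr1n mul1r.
rewrite /A_cofactor !QE !topE [X in ratio_cong _ _ _ X]sgn.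
have floorB n j : ratio_cong p (p ^ s.+1)%N
    (binz (p%:Z * j + (p.-1 - t)%N%:Z) (p%:Z * ((p ^ s)%N%:Z * n))) (binz j ((p ^ s)%N%:Z * n)).
  by apply: (weak n); apply: binz_lower_multiple_floor => //; clear -tp; lia.
have floorA n : ratio_cong p (p ^ s.+1)%N (binz (p%:Z * ((p ^ s)%N%:Z * n) - 1) (p%:Z * l + t%:Z))
    ((-1) ^+ t * binz ((p ^ s)%N%:Z * n - 1) l).
  by apply: (weak n); apply: binz_pred_floor.
do 3![apply: (ratio_congM pp) => //].
Qed.

(* Beukers' descent: G r is replaced successively by G (r - 1), ..., G 0; each
   replacement costs p^s times a function constant on blocks of length p^(r - s),
   over which w sums to a multiple of p^(r - s). *)
Lemma dvdz_sum_tower (G : nat -> int -> int) (w : int -> int) (r L : nat) (c : int) :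
  (forall s l t, (t < p)%N -> ((p ^ s.+1)%N %| G s.+1 (p%:Z * l + t%:Z) - G s l)%Z) ->
  (forall s c, (s <= r)%N -> ((p ^ s)%N %| \sum_(0 <= i < p ^ s) w (c + i%:Z))%Z) ->
  ((p ^ r)%N %| \sum_(0 <= i < p ^ r * L)
     G r ((p ^ r)%N%:Z * c + i%:Z) * w ((p ^ r)%N%:Z * c + i%:Z))%Z.
Proof.
move=> GS wS.
(* [W a x] sums [w] over the [x]-th block of length [p ^ a]. At [s = r] blocks are single points,
   giving the goal; at [s = 0] every [W] is already divisible by [p ^ r]. *)
pose W (a : nat) (x : int) := \sum_(0 <= i < p ^ a) w ((p ^ a)%N%:Z * x + i%:Z).
suff H s : (s <= r)%N -> ((p ^ r)%N %| \sum_(0 <= i < p ^ s * L)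
     G s ((p ^ s)%N%:Z * c + i%:Z) * W (r - s)%N ((p ^ s)%N%:Z * c + i%:Z))%Z.
  have := H r (leqnn r); rewrite subnn; congr (_ %| _)%Z.
  by apply: eq_bigr => i _; rewrite /W big_nat1 expn0 mul1r addr0.
elim: s => [_|s IHs sr].
  by apply: rpred_sum => i _; apply: dvdz_mull; rewrite subn0; apply: wS.
rewrite expnS -mulnA big_nat_blocks.
have -> : \sum_(0 <= m < p ^ s * L) \sum_(0 <= t < p)
    G s.+1 ((p * p ^ s)%N%:Z * c + (p * m + t)%N%:Z)
    * W (r - s.+1)%N ((p * p ^ s)%N%:Z * c + (p * m + t)%N%:Z)
  = \sum_(0 <= m < p ^ s * L)
      (\sum_(0 <= t < p) (G s.+1 (p%:Z * ((p ^ s)%N%:Z * c + m%:Z) + t%:Z) - G s ((p ^ s)%N%:Z * c + m%:Z))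
        * W (r - s.+1)%N (p%:Z * ((p ^ s)%N%:Z * c + m%:Z) + t%:Z))
    + \sum_(0 <= m < p ^ s * L) G s ((p ^ s)%N%:Z * c + m%:Z) * W (r - s)%N ((p ^ s)%N%:Z * c + m%:Z).
  rewrite -big_split; apply: eq_bigr => m _ /=.
  have -> : W (r - s)%N ((p ^ s)%N%:Z * c + m%:Z)
      = \sum_(0 <= t < p) W (r - s.+1)%N (p%:Z * ((p ^ s)%N%:Z * c + m%:Z) + t%:Z).
    rewrite /W; have -> : (r - s = (r - s.+1).+1)%N by lia.
    rewrite expnSr big_nat_blocks; apply: eq_bigr => t _; apply: eq_bigr => i _.
    by congr w; rewrite !PoszM !PoszD PoszM; ring.
  rewrite mulr_sumr -big_split; apply: eq_bigr => t _ /=.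
  rewrite -mulrDl subrK !PoszM !PoszD PoszM; congr (G _ _ * W _ _); ring.
apply: rpredD; last by apply: IHs; lia.
apply: rpred_sum => m _; rewrite big_nat; apply: rpred_sum => t /andP[_ tp].
have -> : (p ^ r = p ^ s.+1 * p ^ (r - s.+1))%N by rewrite -expnD subnKC.
by rewrite PoszM dvdz_mul //; [apply: GS | apply: wS; lia].
Qed.

(** Two absorptions make [k ^+ 2 * T] a multiple of [p ^ (2 * r)], hence [T] too. Replacing
    [1 / k ^ 2] by [inv_sq] costs [T] times a multiple of [p ^ r]. *)
Lemma A_term_nonmultiple (r : nat) (k : int) : ~~ (p %| k)%Z ->
  ((p ^ (3 * r))%N %| A_term ((p ^ r)%N%:Z * n1) ((p ^ r)%N%:Z * n2) ((p ^ r)%N%:Z * n3) ((p ^ r)%N%:Z * n4) k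
    - (p ^ (2 * r))%N%:Z * (n1 * n3) * (A_cofactor r (k - 1) * inv_sq p r k))%Z.
Proof.
move=> pk; set T := A_term _ _ _ _ _; set F := A_cofactor r (k - 1).
have TE : k ^+ 2 * T = (p ^ (2 * r))%N%:Z * (n1 * n3 * F).
  rewrite /T /F /A_term /A_cofactor.
  have topE (a b : int) : (p ^ r)%N%:Z * (a + b) - 1 - (k - 1) = (p ^ r)%N%:Z * a + (p ^ r)%N%:Z * b - k by ring.
  rewrite !topE; set c := binz (_ - k) _; set d := binz (_ - k) _.
  transitivity ((k * binz ((p ^ r)%N%:Z * n1) k) * (k * binz ((p ^ r)%N%:Z * n3) k) * c * d); first ring.
  by rewrite !binz_absorb mul2n -addnn expnD PoszM; ring.
have [z zE] := dvdzP (inv_sqP pp (leqnn r) pk).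
have dT : ((p ^ (2 * r))%N %| T)%Z.
  have pk2 : ~~ (p %| k ^+ 2)%Z by rewrite expr2 prime_dvdzM // negb_or pk.
  by rewrite -(prime_Gauss_dvdz _ _ pp pk2) TE dvdz_mulr.
have -> : T - (p ^ (2 * r))%N%:Z * (n1 * n3) * (F * inv_sq p r k) = - (T * (k ^+ 2 * inv_sq p r k - 1)).
  have -> : (p ^ (2 * r))%N%:Z * (n1 * n3) * (F * inv_sq p r k) = k ^+ 2 * T * inv_sq p r k.
    by rewrite TE; ring.
  by ring.
have -> : (3 * r = 2 * r + r)%N by exact: mulSnr.
by rewrite rpredN expnD PoszM dvdz_mul // zE dvdz_mull.
Qed.

Lemma sum_A_cofactor (r L : nat) (c : int) :
  ((p ^ r)%N %| \sum_(0 <= i < p ^ r * L | ~~ (p %| 1 + ((p ^ r)%N%:Z * c + i%:Z))%Z)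
     A_cofactor r ((p ^ r)%N%:Z * c + i%:Z) * inv_sq p r (1 + ((p ^ r)%N%:Z * c + i%:Z)))%Z.
Proof.
pose w (x : int) : int := if ~~ (p %| 1 + x)%Z then inv_sq p r (1 + x) else 0.
rewrite big_mkcond.
set X := \sum_(_ <= _ < _) _.
have -> : X = \sum_(0 <= i < p ^ r * L)
    A_cofactor r ((p ^ r)%N%:Z * c + i%:Z) * w ((p ^ r)%N%:Z * c + i%:Z).
  by apply: eq_bigr => i _; rewrite /w; case: ifP; rewrite ?mulr0.
apply: dvdz_sum_tower => [s l t|s d sr]; first exact: A_cofactor_floor.
have := sum_inv_sq_block pp (1 + d) p_ge5 sr.
by rewrite big_mkcond; congr (_ %| _)%Z; apply: eq_bigr => i _; rewrite /w addrA.
Qed.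
End Supercongruence.

Unset Implicit Arguments.

Theorem theorem1p2 (p r : nat) (n1 n2 n3 n4 : int) :
  prime p -> (5 <= p)%N -> (1 <= r)%N ->
  (A ((p ^ r)%:Z * n1) ((p ^ r)%:Z * n2) ((p ^ r)%:Z * n3) ((p ^ r)%:Z * n4)
   = A ((p ^ r.-1)%:Z * n1) ((p ^ r.-1)%:Z * n2) ((p ^ r.-1)%:Z * n3)
       ((p ^ r.-1)%:Z * n4) %[mod (p ^ (3 * r))%:Z])%Z.
Proof.
move=> pp p5; case: r => // r _; rewrite [r.+1.-1]/=.
apply/eqP; rewrite eqz_mod_dvd.
pose M := (`|n1| + `|n2| + `|n3| + `|n4|).+1.
have wide (s : nat) := @A_wide ((p ^ s)%N%:Z * n1) ((p ^ s)%N%:Z * n2)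
  ((p ^ s)%N%:Z * n3) ((p ^ s)%N%:Z * n4) (p ^ s * M).
rewrite !{}wide; try by rewrite !abszM /= -!mulnDr ltn_pmul2l ?expn_gt0 ?prime_gt0.
pose T (s : nat) (k : int) := A_term ((p ^ s)%N%:Z * n1) ((p ^ s)%N%:Z * n2)
  ((p ^ s)%N%:Z * n3) ((p ^ s)%N%:Z * n4) k.
pose c : int := - M%:Z.
have -> : (2 * (p ^ r.+1 * M) = p * (p ^ r * (2 * M)))%N by rewrite expnS; ring.
(* The offset [p ^ r.+1 * M] is divisible by [p], so this separates the summation indices prime to
   [p] from the multiples of [p]. *)
rewrite (big_nat_multiples _ _ (fun j => T r.+1 (j%:Z - (p ^ r.+1 * M)%N%:Z))) ?prime_gt0 //.
rewrite -addrA; apply: rpredD.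
  have -> : (p * (p ^ r * (2 * M)) = p ^ r.+1 * (2 * M))%N by rewrite mulnA expnS.
  have -> : \sum_(0 <= i < p ^ r.+1 * (2 * M) | ~~ (p %| i.+1)%N) T r.+1 (i.+1%:Z - (p ^ r.+1 * M)%N%:Z)
    = \sum_(0 <= i < p ^ r.+1 * (2 * M) | ~~ (p %| 1 + ((p ^ r.+1)%N%:Z * c + i%:Z))%Z)
        T r.+1 (1 + ((p ^ r.+1)%N%:Z * c + i%:Z)).
    apply: eq_big => i; last by move=> _; congr T; rewrite /c intS PoszM; ring.
    congr (~~ _); rewrite addrCA rpredDl -?intS //.
    by rewrite expnS PoszM -mulrA; apply: dvdz_mulr.
  set s := \sum_(_ <= _ < _ | _) _.
  have [z zE] := dvdzP (sum_A_cofactor pp p5 n1 n2 n3 n4 r.+1 (2 * M) c).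
  (* The terms are compared with [p ^ (2 * r.+1) * n1 * n3] times the cofactor sum, itself divisible
     by [p ^ r.+1]. *)
  rewrite -[s](subrK ((p ^ (2 * r.+1))%N%:Z * (n1 * n3) * (z * (p ^ r.+1)%N))) -{1}zE mulr_sumr -sumrB.
  apply: rpredD.
    apply: rpred_sum => i pi.
    have := A_term_nonmultiple pp n1 n2 n3 n4 r.+1 pi.
    by rewrite [1 + _ - 1]addrC addKr.
  have -> : (3 * r.+1 = 2 * r.+1 + r.+1)%N by exact: mulSnr.
  rewrite expnD PoszM -mulrA dvdz_mul // mulrA; exact: dvdz_mull.
have -> : (2 * (p ^ r * M) = p ^ r * (2 * M))%N by rewrite mulnCA.
(* The terms at multiples of [p] are matched one by one with those of the lower sum. *)
rewrite -sumrB; apply: rpred_sum => i _.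
have -> : (p * i.+1)%N%:Z - (p ^ r.+1 * M)%N%:Z = p%:Z * (i.+1%:Z - (p ^ r * M)%N%:Z).
  by rewrite expnS !PoszM; ring.
rewrite /T expnS PoszM -!mulrA.
by apply: A_term_multiple => //; apply: dvdz_mulr.
Qed.
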